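(* Let $H$ be a real Hilbert space, $A:H\to H$ a bounded linear operator defined on all of $H$ whose range is not closed, $N$ the null-space of $A$, and let $f\in H$ be such that there is $y\in H$ with $Ay=f$, $y\perp N$. Put $B:=A^*A$, $q:=A^*f$. Let $\epsilon:[0,\infty)\to(0,\infty)$ be a continuous function decaying monotonically to zero with $\int_0^\infty\epsilon(s)\,ds=\infty$. Let $u_0\in H$. Then the problem $$\dot u=-[Bu+\epsilon(t)u-q],\qquad u(0)=u_0,$$ has a unique global solution $u(t)$, the limit $u(\infty):=\lim_{t\to\infty}u(t)$ exists, solves $Au(\infty)=f$, and $u(\infty)=y$. Moreover, if for $\delta>0$ an element $f_\delta\in H$ with $\|f_\delta-f\|\le\delta$ is given and $q_\delta:=A^*f_\delta$, then the problem $$\dot u_\delta=-[Bu_\delta+\epsilon(t)u_\delta-q_\delta],\qquad u_\delta(0)=u_0,$$ has a unique global solution $u_\delta(t)$, and there exists $t_\delta$ such that $$\lim_{\delta\to 0}\|u_\delta(t_\delta)-y\|=0.$$ This $t_\delta$ can be chosen, for example, as a root of the equation $\epsilon(t)=\delta^b$ with $b\in(0,1)$, or as a root of the equation $2\sqrt{\epsilon(t)}=\delta^b$ with $b\in(0,1)$.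
   Context: $A^*$ is the adjoint of $A$; $\dot u=du/dt$; a global solution is one defined for all $t\ge0$. *)

(* Defs.v *)
From HB Require Import structures.
From mathcomp Require Import all_boot all_order all_algebra.
From mathcomp Require Import all_classical all_reals all_analysis.
Import Order.TTheory GRing.Theory Num.Theory.
Import numFieldNormedType.Exports.

Set Implicit Arguments.
Unset Strict Implicit.
Unset Printing Implicit Defensive.

Local Open Scope classical_set_scope.
Local Open Scope ring_scope.

(* A real Hilbert space is a complete normed module [H] over the reals together
   with an inner product [dot] (over the reals a form in [{dot H for idfun}] is
   bilinear, symmetric and positive definite) inducing the norm of [H]. *)
Definition induces_norm (R : realType) (H : completeNormedModType R)
    (dot : {dot H for idfun}) : Prop :=
  forall x : H, dot x x = `|x| ^+ 2.

Definition bounded_operator (R : realType) (H : completeNormedModType R)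
    (A : H -> H) : Prop :=
  exists M : R, forall x : H, `|A x| <= M * `|x|.

(* [adjoint dot A y] is the vector [z] with <A x, y> = <x, z> for all [x]. It is
   unique since [dot] is definite, and exists for bounded linear [A] by the
   Riesz representation theorem; the default value 0 is then never used. *)
Definition adjoint (R : realType) (H : completeNormedModType R)
    (dot : {dot H for idfun}) (A : H -> H) (y : H) : H :=
  xget 0 [set z : H | forall x : H, dot (A x) y = dot x z].

(* [u] solves u' = F(t, u), u(0) = u0 on [0, +oo[; the derivative at 0 is
   one-sided and the values of [u] at negative times are irrelevant. *)
Definition global_solution (R : realType) (H : completeNormedModType R)
    (F : R -> H -> H) (u0 : H) (u : R -> H) : Prop :=
  [/\ u 0 = u0,
      h^-1 *: (u h - u 0) @[h --> 0^'+] --> F 0 (u 0) &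
      forall t : R, 0 < t -> is_derive t 1 u (F t (u t))].

Definition unique_global_solution (R : realType)
    (H : completeNormedModType R) (F : R -> H -> H) (u0 : H) (u : R -> H)
    : Prop :=
  global_solution F u0 u /\
  (forall v : R -> H, global_solution F u0 v ->
     forall t : R, 0 <= t -> v t = u t).

(* -[B u + eps(t) u - q] with B = A^* A and q = A^* g. *)
Definition regularized_flow (R : realType) (H : completeNormedModType R)
    (dot : {dot H for idfun}) (A : H -> H) (eps : R -> R) (g : H)
    (t : R) (u : H) : H :=
  - (adjoint dot A (A u) + eps t *: u - adjoint dot A g).

(* Main.v *)
Require Import Defs.
From HB Require Import structures.
From mathcomp Require Import all_boot all_order all_algebra.
From mathcomp Require Import all_classical all_reals all_analysis.
From mathcomp Require Import ring lra.
Import Order.TTheory GRing.Theory Num.Theory.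
Import numFieldNormedType.Exports.
Local Open Scope classical_set_scope.
Local Open Scope ring_scope.

(** Energy estimates for the regularized flow, with no spectral theory.

    Write B for the composition of the adjoint of A with A.  Two solutions for
    the data g1 and g2 differ by some w with w(0) = 0 and
    w' = -(B w + eps w) + A^*(g1 - g2).  In the derivative of |w|^2 the adjoint
    turns the forcing into <A w, g1 - g2>, which the damping -|A w|^2 absorbs up
    to |g1 - g2|^2 / 4; since eps is nonincreasing, comparison on [0, t] gives
    4 eps(t) |w(t)|^2 <= |g1 - g2|^2 ([noise_estimate]).  For g1 = g2 this is
    uniqueness.  For noisy data it bounds the error by delta / (2 sqrt(eps(t))),
    and the square root is what admits every exponent b in (0, 1) in the second
    stopping rule.

    For exact data, v = u - y satisfies v' = -(B v + eps v) - eps y.  As y is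
    orthogonal to the kernel of A, it is in the closure of the range of B, say
    y = B z + r with r small.  The part eps <A v, A z> of the forcing costs
    eps^2 |A z|^2 / 4, and -eps <v, r> is of order eps |r|^2 once the damping
    has taken its share, so that (|v|^2)' <= -eps |v|^2 + eps k with k
    eventually of the order of the bound chosen for |r|^2.  Because eps has
    infinite integral, the integrating factor makes |v|^2 eventually comparable
    to k ([regularized_error_cvg0]).

    Existence: the integrating factor exp of the primitive of eps reduces the
    problem to equations U' = g(t) x - B U with U(0) = c x.  The solution is the
    series of the c_n(t) B^n x, where c_0' = g and c_0(0) = c, and each later
    c_n is minus the primitive of the preceding one: all integrals are of real
    functions, and the only vector-valued analysis is the termwise
    differentiation of a series ([linear_ode_solution]).  The adjoint and the
    approximation of y rest on the projection onto a closed subspace.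

    Both stopping rules have the form eps(t) = c delta^a with 0 < a < 2: the
    root exists by the intermediate value theorem, it tends to infinity as
    delta tends to 0, and delta^2 / eps(t) is of order delta^(2 - a)
    ([stopping_time_error_cvg0]). *)

Set Implicit Arguments.
Unset Strict Implicit.
Unset Printing Implicit Defensive.

(** * Orthogonal projection and the Riesz representation *)

Section InnerProduct.
Context {R : realType} {H : completeNormedModType R} {dot : {dot H for idfun}}.
Hypothesis dot_norm : induces_norm dot.

Lemma dotC (x y : H) : dot x y = dot y x.
Proof. by rewrite hermC/= expr0 mul1r. Qed.

Lemma dotDl (x y z : H) : dot (x + y) z = dot x z + dot y z.
Proof. by rewrite linearDl. Qed.

Lemma dotNl (x z : H) : dot (- x) z = - dot x z.
Proof. by rewrite linearNl. Qed.

Lemma dotZl (a : R) (x z : H) : dot (a *: x) z = a * dot x z.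
Proof. by rewrite linearZl_LR. Qed.

Lemma dotDr (x y z : H) : dot z (x + y) = dot z x + dot z y.
Proof. by rewrite ![dot z _]dotC dotDl. Qed.

Lemma dotNr (x z : H) : dot z (- x) = - dot z x.
Proof. by rewrite ![dot z _]dotC dotNl. Qed.

Lemma dotZr (a : R) (x z : H) : dot z (a *: x) = a * dot z x.
Proof. by rewrite ![dot z _]dotC dotZl. Qed.

Let dotE := (dotDl, dotDr, dotNl, dotNr, dotZl, dotZr).

Lemma normD_sqr (x y : H) : `|x + y| ^+ 2 = `|x| ^+ 2 + 2 * dot x y + `|y| ^+ 2.
Proof. by rewrite -!dot_norm !dotE (dotC y x); ring. Qed.

Lemma normB_sqr (x y : H) : `|x - y| ^+ 2 = `|x| ^+ 2 - 2 * dot x y + `|y| ^+ 2.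
Proof. by rewrite normD_sqr dotNr normrN mulrN. Qed.

Lemma dot_eq0 (z : H) : (forall x, dot x z = 0) -> z = 0.
Proof.
move=> /(_ z) /eqP; rewrite dot_norm expf_eq0/= normr_eq0.
exact: eqP.
Qed.

Lemma dot_inj (a b : H) : (forall x, dot x a = dot x b) -> a = b.
Proof.
by move=> ab; apply/subr0_eq/dot_eq0 => x; rewrite dotDr dotNr ab subrr.
Qed.

(** Young's inequality with a weight; it does all that the Cauchy-Schwarz
    inequality would be used for below. *)
Lemma le_dot (c : R) (x y : H) : 0 < c ->
  dot x y <= c * `|x| ^+ 2 + `|y| ^+ 2 / (4 * c).
Proof.
move=> c0; have : 0 <= `|(2 * c) *: x - y| ^+ 2 / (4 * c).
  by rewrite divr_ge0 ?sqr_ge0// mulr_ge0// ltW.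
rewrite normB_sqr normrZ exprMn real_normK ?num_real// dotZl => h.
rewrite -subr_ge0; apply: le_trans h _.
by rewrite le_eqVlt; apply/orP; left; apply/eqP; field; rewrite gt_eqF.
Qed.

(** By polarization the inner product is a combination of norms, hence
    continuous without any boundedness estimate. *)
Lemma cvg_dot (T : Type) (F : set_system T) (FF : Filter F) (f g : T -> H)
    (a b : H) :
  f x @[x --> F] --> a -> g x @[x --> F] --> b ->
  dot (f x) (g x) @[x --> F] --> dot a b.
Proof.
move=> fa gb.
have polar (x y : H) : dot x y = 4^-1 * (`|x + y| ^+ 2 - `|x - y| ^+ 2).
  by rewrite normD_sqr normB_sqr; field.
rewrite polar; under eq_fun do rewrite polar.
apply: cvgMr; apply: cvgB; rewrite !expr2.
  by apply: cvgM; apply: cvg_norm; apply: cvgD.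
by apply: cvgM; apply: cvg_norm; apply: cvgB.
Qed.

(** A minimizing sequence for the distance from x to S is Cauchy by the
    parallelogram law, and its limit p is a minimum; the first variation in the
    direction of s then vanishes. *)
Lemma closed_subspace_projection (S : set H) : closed S -> S 0 ->
  (forall (a : R) x y, S x -> S y -> S (a *: x + y)) ->
  forall x, exists2 p, S p & forall s, S s -> dot (x - p) s = 0.
Proof.
move=> Sc S0 Slin x.
pose D := [set `|x - s| ^+ 2 | s in S]; pose d := inf D.
have Dinf : has_inf D.
  split; first by exists (`|x - 0| ^+ 2), 0.
  by exists 0 => _ [s _ <-]; exact: sqr_ge0.
have dle s : S s -> d <= `|x - s| ^+ 2.
  by move=> Ss; apply: ge_inf; [exact: Dinf.2|exists s].
have /choice[s sP] (n : nat) :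
    exists s, S s /\ `|x - s| ^+ 2 < d + n.+1%:R^-1.
  have n0 : (0 : R) < n.+1%:R^-1 by rewrite invr_gt0.
  by have [_ [s Ss <-] lts] := inf_adherent n0 Dinf; exists s.
have smid m n : `|s m - s n| ^+ 2 <= 2 * m.+1%:R^-1 + 2 * n.+1%:R^-1.
  have Smid : S (2^-1 *: s m + 2^-1 *: s n).
    by apply: (Slin) (sP m).1 _; rewrite -[X in S X]addr0; exact: Slin (sP n).1 S0.
  have := dle _ Smid; have := (sP m).2; have := (sP n).2.
  rewrite -!dot_norm !dotE (dotC (s m) x) (dotC (s n) x) (dotC (s n) (s m)).
  move: m.+1%:R^-1 n.+1%:R^-1 (dot _ _) (dot _ _) (dot _ _) (dot _ _) => *.
  lra.
have scvg : cvg (s @ \oo).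
  apply: cauchy_cvg; apply/cauchy_ballP => e e0.
  have e4 : 0 < e ^+ 2 / 4 by rewrite divr_gt0// exprn_gt0.
  have near_small : \forall n \near \oo, n.+1%:R^-1 < e ^+ 2 / 4.
    exact: near_infty_natSinv_lt (PosNum e4).
  rewrite near_map2; near=> m n => /=.
  rewrite -ball_normE/= -(@ltr_pXn2r _ 2)// ?nnegrE ?normr_ge0 ?(ltW e0)//.
  apply: le_lt_trans (smid m n) _.
  have : m.+1%:R^-1 < e ^+ 2 / 4 by near: m.
  have : n.+1%:R^-1 < e ^+ 2 / 4 by near: n.
  by move: m.+1%:R^-1 n.+1%:R^-1 => *; lra.
pose p := lim (s @ \oo).
have Sp : S p.
  apply: (@closed_cvg _ _ \oo _ s S) => //.
  by near=> n; exact: (sP n).1.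
exists p => // t St.
have pd : `|x - p| ^+ 2 <= d.
  have cl : `|x - s n| ^+ 2 @[n --> \oo] --> `|x - p| ^+ 2.
    rewrite !expr2; apply: cvgM; apply: cvg_norm; apply: cvgB => //; exact: cvg_cst.
  have cr : d + n.+1%:R^-1 @[n --> \oo] --> d + 0.
    by apply: cvgD; [exact: cvg_cst|exact: cvg_harmonic].
  rewrite -[d]addr0; apply: ler_cvg_to cl cr _.
  by near=> n; exact: ltW (sP n).2.
have var a : 0 <= a ^+ 2 * `|t| ^+ 2 - 2 * a * dot (x - p) t.
  have : S (a *: t + p) by exact: Slin.
  move=> /dle; rewrite opprD addrCA addrC normD_sqr.
  rewrite normrN normrZ exprMn real_normK ?num_real// dotNr dotZr.
  by move: pd; lra.
have [t0|t0] := eqVneq (`|t| ^+ 2) 0.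
  move: t0 => /eqP; rewrite expf_eq0/= normr_eq0 => /eqP ->.
  by rewrite linear0r.
(* The quadratic polynomial in [var] is nonnegative at its minimum only if
   its linear coefficient vanishes. *)
have := var (dot (x - p) t / `|t| ^+ 2).
set k := dot _ _; set N := `|t| ^+ 2 in t0 *.
have N0 : 0 < N by rewrite lt_neqAle eq_sym t0 sqr_ge0.
have -> : (k / N) ^+ 2 * N - 2 * (k / N) * k = - (k ^+ 2 / N) by field.
rewrite oppr_ge0 => h.
have : k ^+ 2 <= 0 by rewrite -(pmulr_lle0 _ (_ : 0 < N^-1)) ?invr_gt0.
by rewrite le_eqVlt ltNge sqr_ge0 orbF expf_eq0/= => /eqP.
Unshelve. all: by end_near. Qed.

(** The kernel of l is closed, and a nonzero vector orthogonal to it, suitably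
    scaled, represents l. *)
Lemma riesz_representation (l : {linear H -> R}) : continuous l ->
  exists z, forall x, l x = dot x z.
Proof.
move=> lc.
have [l0|/existsNP[x lx]] := pselect (forall x, l x = 0).
  by exists 0 => x; rewrite l0 linear0r.
have [||a u v lu lv|p lp ort] := @closed_subspace_projection [set u | l u = 0] _ _ _ x.
- by apply: preimage_closed (@closed_eq _ 0) => u _; exact: lc.
- by rewrite /= linear0.
- by rewrite /= linearP lu lv scaler0 addr0.
have lxp : l (x - p) = l x by rewrite linearB/= lp subr0.
have n0 : `|x - p| ^+ 2 != 0.
  rewrite expf_eq0/= normr_eq0; apply/eqP => xp0.
  by apply: lx; rewrite -lxp xp0 linear0.
exists ((l x / `|x - p| ^+ 2) *: (x - p)) => u.
have lxn0 : l x != 0 by apply/eqP.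
have := ort (u - (l u / l x) *: (x - p)).
rewrite /= linearB linearZ/= lxp /GRing.scale/= divfK// subrr => /(_ erefl).
rewrite dotDr dotNr dotZr dot_norm => /eqP; rewrite subr_eq0 dotZr (dotC u) => /eqP ->.
by move: n0 lxn0; move: (_ ^+ 2) => c c0 lx0; field; apply/andP; split.
Qed.

End InnerProduct.

(** * The adjoint of a bounded operator *)

Section Adjoint.
Context {R : realType} {H : completeNormedModType R} {dot : {dot H for idfun}}.
Hypothesis dot_norm : induces_norm dot.
Context {A : {linear H -> H}}.
Hypothesis A_bounded : bounded_operator A.

Local Notation Ast := (adjoint dot A).

Lemma bounded_operator_continuous (B : {linear H -> H}) :
  bounded_operator B -> continuous B.
Proof.
move=> [M BM]; apply/linear_bounded_continuous/linear_boundedP.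
exists M; split=> [|r Mr x]; first exact: num_real.
by apply: le_trans (BM x) _; rewrite ler_wpM2r// ltW.
Qed.

Lemma adjointP (x z : H) : dot (A x) z = dot x (Ast z).
Proof.
rewrite /adjoint; case: xgetP => [w _ wz|none]; [exact: wz|exfalso].
have lin : linear (fun u => dot (A u) z : R).
  by move=> a u v; rewrite linearP dotDl dotZl.
pose l : {linear H -> R} := HB.pack (fun u => dot (A u) z : R)
  (GRing.isLinear.Build R H R _ (fun u => dot (A u) z : R) lin).
have [|w lw] := @riesz_representation _ _ _ dot_norm l.
  move=> u; apply: (cvg_dot dot_norm); last exact: cvg_cst.
  exact: bounded_operator_continuous.
by apply: (none w) => u; exact: lw.
Qed.

Lemma adjoint_linear : linear Ast.
Proof.
move=> a u v; apply/subr0_eq/(dot_eq0 dot_norm) => x.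
by rewrite !(dotDr, dotNr, dotZr) -!adjointP !(dotDr, dotZr) subrr.
Qed.

Lemma adjointB (a b : H) : Ast (a - b) = Ast a - Ast b.
Proof.
have := adjoint_linear (-1) b a; rewrite !scaleN1r.
by rewrite (addrC (- b)) (addrC (- Ast b)).
Qed.

(** The bound |A^* z|^2 = <A (A^* z), z> <= K |A^* z| |z|, with Young's inequality
    weighted so that half of |A^* z|^2 is absorbed. *)
Lemma adjoint_bounded : bounded_operator Ast.
Proof.
case: A_bounded => M AM; exists (`|M| + 1) => z.
set K := `|M| + 1; have K0 : 0 < K by rewrite ltr_wpDl.
have AK x : `|A x| <= K * `|x|.
  apply: le_trans (AM x) _; rewrite ler_wpM2r//.
  by apply: le_trans (ler_norm _) _; rewrite lerDl.
have c0 : 0 < 1 / (2 * K ^+ 2) by rewrite divr_gt0// mulr_gt0// exprn_gt0.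
have := le_dot dot_norm (A (Ast z)) z c0.
rewrite adjointP dot_norm => h.
have : `|A (Ast z)| ^+ 2 <= K ^+ 2 * `|Ast z| ^+ 2.
  by rewrite -exprMn ler_pXn2r// nnegrE// mulr_ge0// ltW.
rewrite -(ler_pM2l c0) => h'.
have {h h'} := le_trans h (lerD h' (lexx _)).
have -> : 1 / (2 * K ^+ 2) * (K ^+ 2 * `|Ast z| ^+ 2) = `|Ast z| ^+ 2 / 2.
  by field; rewrite gt_eqF.
have -> : `|z| ^+ 2 / (4 * (1 / (2 * K ^+ 2))) = (K * `|z|) ^+ 2 / 2.
  by field; rewrite gt_eqF.
move=> h; have {}h : `|Ast z| ^+ 2 <= (K * `|z|) ^+ 2 by lra.
by rewrite -(@ler_pXn2r _ 2)// nnegrE// mulr_ge0// ltW.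
Qed.

(** Let n be the difference between y and its projection onto the closure of
    the range of A^* A.  Orthogonality to A^* (A n) gives A n = 0; hence y is
    orthogonal to n, and so is the projection: n = 0. *)
Lemma approx_by_range_of_normal_operator (y : H) :
  (forall x, A x = 0 -> dot y x = 0) ->
  forall eta : R, 0 < eta -> exists z, `|y - Ast (A z)| < eta.
Proof.
move=> y_orth.
pose S := [set u : H | forall e : R, 0 < e -> exists z, `|u - Ast (A z)| < e].
have Ast0 : Ast 0 = 0 by have := adjoint_linear (-1) 0 0; rewrite scaler0 addr0 scaleN1r addNr.
have AstD u v : Ast (u + v) = Ast u + Ast v.
  by have := adjoint_linear 1 u v; rewrite !scale1r.
have AstZ a u : Ast (a *: u) = a *: Ast u.
  by have := adjoint_linear a u 0; rewrite Ast0 !addr0.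
have [||a u v Su Sv e e0|p Sp ort] := @closed_subspace_projection _ _ _ dot_norm S _ _ _ y.
- move=> u clu e e0; have e2 : 0 < e / 2 by rewrite divr_gt0.
  have [v [Sv]] := clu _ (nbhsx_ballx u (e / 2) e2).
  rewrite -ball_normE/= => uv; have [z vz] := Sv _ e2; exists z.
  rewrite -(subrK v u) -addrA (le_lt_trans (ler_normD _ _))//.
  by rewrite [ltRHS](splitr e) ltrD.
- by move=> e e0; exists 0; rewrite linear0 Ast0 subr0 normr0.
- have c0 : 0 < e / (2 * (`|a| + 1)) by rewrite divr_gt0// mulr_gt0// ltr_wpDl.
  have e2 : 0 < e / 2 by rewrite divr_gt0.
  have [z uz] := Su _ c0; have [w vw] := Sv _ e2.
  exists (a *: z + w); rewrite linearP AstD AstZ opprD addrACA -scalerBr.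
  rewrite (le_lt_trans (ler_normD _ _))// [ltRHS](splitr e) ler_ltD// normrZ.
  apply: le_trans (ler_wpM2l (normr_ge0 a) (ltW uz)) _.
  rewrite -subr_ge0.
  have -> : e / 2 - `|a| * (e / (2 * (`|a| + 1))) = e / (2 * (`|a| + 1)).
    by field; rewrite gt_eqF// ltr_wpDl.
  exact: ltW.
set n := y - p in ort *.
have An0 : A n = 0.
  have : S (Ast (A n)) by move=> e e0; exists n; rewrite subrr normr0.
  move=> /ort; rewrite -adjointP dot_norm => /eqP.
  by rewrite expf_eq0/= normr_eq0 => /eqP.
have : dot n n = 0.
  by rewrite {1}/n dotDl dotNl (y_orth _ An0) (dotC p) (ort _ Sp) subr0.
rewrite dot_norm => /eqP; rewrite expf_eq0/= normr_eq0 => /eqP/subr0_eq yp.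
by move=> eta eta0; rewrite yp; exact: Sp.
Qed.

End Adjoint.

(** * Curves in normed spaces and termwise differentiation *)

Section Calculus.
Context {R : realType}.
Implicit Types (V : completeNormedModType R).

(** Difference quotients of curves, free of the product h *: 1 by which
    directional derivatives are defined. *)
Lemma is_deriveP (V : normedModType R) (u : R -> V) (t : R) (d : V) :
  is_derive t 1 u d <-> h^-1 *: (u (t + h) - u t) @[h --> 0^'] --> d.
Proof.
have E : (fun h => h^-1 *: ((u \o shift t) (h *: 1) - u t)) =
         (fun h => h^-1 *: (u (t + h) - u t)).
  by apply/funext => h /=; rewrite [h *: 1]mulr1 [h + t]addrC.
split=> [[du <-]|ud].
  by move: du; rewrite /derivable /derive E.
have du : derivable u t 1 by rewrite /derivable E; apply/cvg_ex; exists d.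
split=> //; rewrite /derive E; exact: cvg_lim.
Qed.

Lemma is_derive_continuous (V : normedModType R) (u : R -> V) (t : R) (d : V) :
  is_derive t 1 u d -> {for t, continuous u}.
Proof. by move=> [du _]; apply/differentiable_continuous/derivable1_diffP. Qed.

Lemma is_derive_cvg_shift (V : normedModType R) (u : R -> V) (t : R) (d : V) :
  is_derive t 1 u d -> u (t + h) @[h --> 0^'] --> u t.
Proof.
move=> /is_derive_continuous ut.
have : t + h @[h --> 0^'] --> t.
  rewrite -[X in _ --> X]addr0; apply: cvgD; first exact: cvg_cst.
  exact: nbhs_dnbhs.
by move=> th; apply: cvg_comp th ut.
Qed.

Lemma is_derive_scale (V : normedModType R) (a : R -> R) (u : R -> V)
    (t : R) (da : R) (du : V) :
  is_derive t 1 a da -> is_derive t 1 u du ->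
  is_derive t 1 (fun s => a s *: u s) (da *: u t + a t *: du).
Proof.
move=> a_der u_der; apply/is_deriveP.
have -> : (fun h => h^-1 *: (a (t + h) *: u (t + h) - a t *: u t)) =
    (fun h => (h^-1 *: (a (t + h) - a t)) *: u (t + h) +
              a t *: (h^-1 *: (u (t + h) - u t))).
  apply/funext => h; rewrite -[h^-1 *: (_ - _) in RHS]/(h^-1 * _) -scalerA.
  rewrite [a t *: (_ *: _)]scalerA (mulrC (a t)) -scalerA -scalerDr.
  by congr (_ *: _); rewrite scalerBl scalerBr addrA subrK.
apply: cvgD.
  apply: cvgZ; first exact/is_deriveP.
  exact: is_derive_cvg_shift u_der.
by apply: cvgZr; exact/is_deriveP.
Qed.

(** Tannery's theorem: the tail of the series is bounded uniformly by that of
    M, and the remaining finite sum tends to 0. *)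
Lemma cvg_series_dominated V (T : Type) (F : set_system T)
    (FF : ProperFilter F) (a : T -> nat -> V) (M : nat -> R) :
  cvgn (series M) -> (\forall h \near F, forall n, `|a h n| <= M n) ->
  (forall n, a h n @[h --> F] --> 0) ->
  limn (series (a h)) @[h --> F] --> 0.
Proof.
move=> cM aM a0; apply/cvgr0Pnorm_lt => e e0.
have M0 n : 0 <= M n.
  near F => h; have : `|a h n| <= M n by near: h; apply: filterS aM => h; exact.
  exact: le_trans.
have e2 : 0 < e / 2 by rewrite divr_gt0.
have [N _ /(_ N (leqnn N)) MN] : \forall N \near \oo, limn (series M) - series M N < e / 2.
  have : limn (series M) - series M N @[N --> \oo] --> limn (series M) - limn (series M).
    by apply: cvgB => //; exact: cvg_cst.
  by rewrite subrr => /cvgr_lt; apply.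
have head : series (a h) N @[h --> F] --> (0 : V).
  rewrite -[X in _ --> X](_ : \sum_(i < N) 0 = 0); last by rewrite big1.
  rewrite /series/=; under eq_fun do rewrite big_mkord.
  by apply: cvg_big => [|i _]; [exact: add_continuous|exact: a0].
have headN : \forall h \near F, `|series (a h) N| < e / 2.
  by move/cvgr0Pnorm_lt : head; apply.
near=> h.
have ahM n : `|a h n| <= M n by move: n; near: h.
have cn : cvgn [normed series (a h)].
  by apply: series_le_cvg cM => // n /=.
have ca := normed_cvg cn.
have tail : \forall K \near \oo,
    `|series (a h) K| <= `|series (a h) N| + (limn (series M) - series M N).
  near=> K; have NK : (N <= K)%N by near: K; exists N.
  rewrite -[series (a h) K](subrK (series (a h) N)) addrC.
  apply: le_trans (ler_normD _ _) _; rewrite lerD2l sub_series_geq//.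
  apply: le_trans (ler_norm_sum _ _ _) _.
  apply: (@le_trans _ _ (\sum_(N <= k < K) M k)).
    by apply: ler_sum.
  rewrite -sub_series_geq// lerD2r; apply: nondecreasing_cvgn_le => //.
  exact: nondecreasing_series.
have : `|limn (series (a h))| <= `|series (a h) N| + (limn (series M) - series M N).
  have cl := cvg_norm ca.
  by apply: (ler_cvg_to (cl _) (cvg_cst _) tail).
move=> /le_lt_trans; apply; rewrite [ltRHS](splitr e) ltrD//.
by near: h.
Unshelve. all: by end_near. Qed.

(** The coefficients are real functions, so the scalar mean value theorem
    bounds the n-th term of the difference quotient by M n and dominated
    convergence applies: no mean value inequality for
    vector-valued functions is involved. *)
Lemma is_derive_series V (c c' : nat -> R -> R) (x : nat -> V) (M : nat -> R)
    (T t : R) : `|t| < T ->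
  (forall (n : nat) (s : R), `|s| < T -> is_derive s 1 (c n) (c' n s)) ->
  (forall (n : nat) (s : R), `|s| < T -> `|c' n s| * `|x n| <= M n) ->
  cvgn (series M) ->
  (forall s : R, `|s| < T -> cvgn (series (fun n => c n s *: x n))) ->
  is_derive t 1 (fun s => limn (series (fun n => c n s *: x n)))
                (limn (series (fun n => c' n t *: x n))).
Proof.
move=> tT cc' c'M cM cs.
set U := fun s : R => limn _; set D := limn _; apply/is_deriveP.
have cs' : cvgn (series (fun n => c' n t *: x n)).
  apply: normed_cvg; apply: series_le_cvg cM => //= n.
    exact: le_trans (c'M n t tT).
  by rewrite normrZ; exact: c'M.
pose a h n : V := (h^-1 *: (c n (t + h) - c n t) - c' n t) *: x n.
have tT_near : \forall h \near 0^', `|t + h| < T.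
  have : t + h @[h --> (0 : R)^'] --> t.
    rewrite -[X in _ --> X]addr0; apply: cvgD; first exact: cvg_cst.
    exact: nbhs_dnbhs.
  by move=> /cvg_norm /cvgr_lt; apply.
have a0 : limn (series (a h)) @[h --> 0^'] --> 0.
  apply: (@cvg_series_dominated _ _ _ _ a (fun n => 2 * M n)).
  - exact: is_cvg_seriesZ.
  - near=> h => n.
    have thT : `|t + h| < T by near: h.
    have h0 : h != 0 by near: h; exact: nbhs_dnbhs_neq.
    have [s sT ds] : exists2 s, `|s| < T & c n (t + h) - c n t = c' n s * h.
      have cont (p q : R) : `|p| < T -> `|q| < T -> {within `[p, q], continuous (c n)}.
        move=> pT qT; apply: continuous_in_subspaceT => s; rewrite inE/= in_itv/= => /andP[ps sq].
        apply: is_derive_continuous (cc' n s _).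
        by move: pT qT; rewrite !ltr_norml => /andP[? ?] /andP[? ?]; apply/andP; split; lra.
      have dom (p q s : R) : `|p| < T -> `|q| < T -> s \in `]p, q[ -> `|s| < T.
        rewrite in_itv/= !ltr_norml => /andP[? ?] /andP[? ?] /andP[? ?]; apply/andP; split; lra.
      have [hlt|hgt|h00] := ltgtP h 0.
      + have [|||s sI e] := @MVT _ (c n) (c' n) (t + h) t.
        * by rewrite gtrDl.
        * by move=> s /(dom _ _ _ thT tT); exact: cc'.
        * exact: cont.
        exists s; first exact: dom sI.
        by rewrite -[LHS]opprB e opprD addrA subrr sub0r mulrN opprK.
      + have [|||s sI e] := @MVT _ (c n) (c' n) t (t + h).
        * by rewrite ltrDl.
        * by move=> s /(dom _ _ _ tT thT); exact: cc'.
        * exact: cont.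
        exists s; first exact: dom sI.
        by rewrite e addrAC subrr add0r.
      + by rewrite h00 eqxx in h0.
    rewrite /a ds normrZ [h^-1 *: _]mulrC mulfK//.
    apply: le_trans (ler_wpM2r (normr_ge0 _) (ler_normB _ _)) _.
    by rewrite mulrDl mulr2n mulrDl mul1r lerD// c'M.
  - move=> n; rewrite -[X in _ --> X](scale0r (x n)); apply: cvgZl.
    rewrite -[X in _ --> X](subrr (c' n t)); apply: cvgB; last exact: cvg_cst.
    by have /is_deriveP := cc' n t tT.
have aE : \forall h \near 0^', limn (series (a h)) + D = h^-1 *: (U (t + h) - U t).
  near=> h; have thT : `|t + h| < T by near: h.
  apply/eqP; rewrite -[eqbRHS](subrK D) (inj_eq (addIr _)); apply/eqP.
  apply: cvg_lim; first exact: norm_hausdorff.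
  have -> : series (a h) = (fun n => h^-1 *: (series (fun n => c n (t + h) *: x n) n -
      series (fun n => c n t *: x n) n) - series (fun n => c' n t *: x n) n).
    apply/funext => n; rewrite /series/= -!sumrB scaler_sumr -sumrB.
    apply: eq_bigr => k _; rewrite /a scalerBl -[h^-1 *: (_ - _)]/(h^-1 * _).
    by rewrite -scalerA scalerBl.
  by apply: cvgB => //; apply: cvgZr; apply: cvgB; exact: cs.
apply: cvg_trans (near_eq_cvg aE) _.
have : limn (series (a h)) + D @[h --> 0^'] --> 0 + D.
  by apply: cvgD => //; exact: cvg_cst.
by rewrite add0r.
Unshelve. all: by end_near. Qed.

End Calculus.

(** * Primitives of continuous functions on the line *)

Section Primitive.
Context {R : realType}.
Local Notation mu := (@lebesgue_measure R).

Lemma continuous_itv_integrable (g : R -> R) (a b : R) :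
  continuous g -> mu.-integrable `[a, b] (EFin \o g).
Proof.
move=> cg; apply: continuous_compact_integrable; first exact: segment_compact.
exact: continuous_subspaceT.
Qed.

(** A base point below both 0 and t makes the formula independent of the sign
    of t, and differentiable across 0. *)
Definition primitive (g : R -> R) (t : R) : R :=
  \int[mu]_(s in `[- (`|t| + 1), t]) g s - \int[mu]_(s in `[- (`|t| + 1), 0]) g s.

Lemma primitiveE (g : R -> R) (K t : R) : continuous g -> `|t| + 1 <= K ->
  primitive g t = \int[mu]_(s in `[- K, t]) g s - \int[mu]_(s in `[- K, 0]) g s.
Proof.
move=> cg tK; set k := `|t| + 1.
have split u : - k <= u ->
    \int[mu]_(s in `[- K, u]) g s - \int[mu]_(s in `[- K, - k]) g s =
    \int[mu]_(s in `[- k, u]) g s.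
  move=> ku; rewrite Rintegral_itvB ?bnd_simp ?lerN2//; last exact: continuous_itv_integrable.
  rewrite Rintegral_itv_obnd_cbnd//.
  apply: integrableS (continuous_itv_integrable (- k) u cg) => //.
  by apply: subset_itvr; rewrite bnd_simp.
rewrite /primitive -/k -!split; first by rewrite opprB addrA subrK.
  by rewrite oppr_le0 addr_ge0.
rewrite lerNl /k; apply: le_trans (ler_norm _) _; rewrite normrN lerDl//.
Qed.

Lemma primitive0 (g : R -> R) : primitive g 0 = 0.
Proof. by rewrite /primitive subrr. Qed.

Lemma is_derive_primitive (g : R -> R) (t : R) : continuous g ->
  is_derive t 1 (primitive g) (g t).
Proof.
move=> cg; pose K : R := `|t| + 2.
pose F (u : R) : R := \int[mu]_(s in `[- K, u]) g s.
have tK : - K < t < K.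
  by rewrite -ltr_norml ltrDl.
have [dF F'] : derivable F t 1 /\ (F^`())%classic t = g t.
  apply: (@continuous_FTC1_closed _ g (- K) t K) => //.
  - by case/andP: tK.
  - exact: continuous_itv_integrable.
  - by case/andP: tK.
  - exact: cg.
have dF' : is_derive t 1 F (g t).
  by apply: DeriveDef; [exact: dF|rewrite -derive1E; exact: F'].
have dG : is_derive t 1 (F - cst (F 0)) (g t - 0).
  by apply: is_deriveB => //; exact: is_derive_cst.
rewrite subr0 in dG; apply: near_eq_is_derive dG.
near=> s; rewrite /F (@primitiveE g K)// /K.
have : `|t - s| < 1 by near: s; exact: (@cvgr_dist_lt _ _ _ (nbhs t) _ id t).
by have := ler_normD (s - t) t; rewrite subrK distrC; lra.
Unshelve. all: by end_near. Qed.

Lemma continuous_primitive (g : R -> R) : continuous g -> continuous (primitive g).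
Proof. by move=> cg t; apply: is_derive_continuous (is_derive_primitive t cg). Qed.

Lemma is_derive_pow_fact (n : nat) (t : R) :
  is_derive t 1 (fun s : R => s ^+ n.+1 / n.+1`!%:R) (t ^+ n / n`!%:R).
Proof.
have dn : is_derive t 1 (fun s : R => s ^+ n.+1) (n.+1%:R * t ^+ n).
  have := is_deriveX n.+1 (is_derive_id t 1).
  by rewrite exprfctE/= [_ *: 1]mulr1.
have := is_deriveZ (n.+1`!%:R^-1 : R) dn.
have -> : (n.+1`!%:R^-1 : R) *: (n.+1%:R * t ^+ n) = t ^+ n / n`!%:R.
  have n0 : n.+1%:R != 0 :> R by rewrite pnatr_eq0.
  have f0 : n`!%:R != 0 :> R by rewrite pnatr_eq0 -lt0n fact_gt0.
  rewrite -[LHS]/(_ * _) factS natrM; move: n0 f0; move: n.+1%:R n`!%:R => a b a0 b0.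
  by field; rewrite a0 b0.
congr is_derive; apply/funext => s.
by rewrite -[LHS]/(_ * _) mulrC.
Qed.

(** Cauchy's mean value theorem compares the primitive with s^(n+1) / (n+1)!,
    on [0, t] or on [t, 0], with no discussion of signs. *)
Lemma primitive_pow_bound (f : R -> R) (n : nat) (C T t : R) : continuous f ->
  (forall s, `|s| <= T -> `|f s| <= C * (`|s| ^+ n / n`!%:R)) -> `|t| <= T ->
  `|primitive f t| <= C * (`|t| ^+ n.+1 / n.+1`!%:R).
Proof.
move=> cf fC tT.
pose p k (s : R) := s ^+ k / k`!%:R.
have normp k s : `|p k s| = `|s| ^+ k / k`!%:R by rewrite normrM normrX normfV normr_nat.
have pn0 k s : s != 0 -> p k s != 0.
  by move=> s0; rewrite mulf_neq0// ?expf_neq0// invr_eq0 pnatr_eq0 -lt0n fact_gt0.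
have [->|t0] := eqVneq t 0.
  by rewrite primitive0 normr0 expr0n/= mul0r mulr0.
have [s [s0 st e]] : exists s,
    [/\ s != 0, `|s| <= `|t| & f s * p n.+1 t = p n s * primitive f t].
  have cF : continuous (primitive f) := continuous_primitive cf.
  have cp : continuous (p n.+1) by move=> s; exact: is_derive_continuous (is_derive_pow_fact n s).
  have p0 : p n.+1 0 = 0 by rewrite /p expr0n mul0r.
  have [tlt|tgt|//] := ltgtP t 0; last by move=> t00; rewrite t00 eqxx in t0.
  - have [|||||s] := @cauchy_MVT R (primitive f) f (p n.+1) (p n) t 0 tlt.
    + exact: continuous_subspaceT.
    + exact: continuous_subspaceT.
    + by move=> s _; exact: is_derive_primitive.
    + by move=> s _; exact: is_derive_pow_fact.
    + by move=> s; rewrite in_itv/= => /andP[_ s0]; apply: pn0; rewrite lt_eqF.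
    rewrite in_itv/= => /andP[ts s0]; rewrite p0 primitive0 !sub0r invrN mulrNN => e.
    exists s; rewrite lt_eqF//; split=> //; first by rewrite !ltr0_norm ?lerN2 ?ltW.
    have sn0 : s != 0 by rewrite lt_eqF.
    by apply/eqP; rewrite [eqbRHS]mulrC -eqr_div ?pn0// e.
  - have [|||||s] := @cauchy_MVT R (primitive f) f (p n.+1) (p n) 0 t tgt.
    + exact: continuous_subspaceT.
    + exact: continuous_subspaceT.
    + by move=> s _; exact: is_derive_primitive.
    + by move=> s _; exact: is_derive_pow_fact.
    + by move=> s; rewrite in_itv/= => /andP[s0 _]; apply: pn0; rewrite gt_eqF.
    rewrite in_itv/= => /andP[s0 ts]; rewrite p0 primitive0 !subr0 => e.
    exists s; rewrite gt_eqF//; split=> //; first by rewrite !gtr0_norm ?ltW.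
    have sn0 : s != 0 by rewrite gt_eqF.
    by apply/eqP; rewrite [eqbRHS]mulrC -eqr_div ?pn0// e.
have {}e : `|f s| * `|p n.+1 t| = `|p n s| * `|primitive f t| by rewrite -!normrM e.
rewrite -normp.
rewrite -(@ler_pM2l _ `|p n s|) ?normr_gt0 ?pn0// -e mulrA ler_wpM2r//.
by rewrite mulrC normp fC// (le_trans st).
Qed.

End Primitive.

(** * Linear differential equations with a bounded operator *)

Section LinearODE.
Context {R : realType} {V : completeNormedModType R}.

(** The coefficients c_n of the series that sums the c_n(t) B^n x: c_0 = c0,
    and c_n is for n > 0 the solution of c_n' = -c_(n-1) that vanishes at 0. *)
Definition coef (c0 : R -> R) (n : nat) : R -> R :=
  iter n (fun c t => - primitive c t) c0.

Lemma continuous_coef (c0 : R -> R) (n : nat) :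
  continuous c0 -> continuous (coef c0 n).
Proof.
move=> cc; elim: n => [//|n IH] t.
by apply: cvgN; exact: continuous_primitive.
Qed.

Lemma coef_bound (c0 : R -> R) (C T t : R) (n : nat) : continuous c0 ->
  (forall s, `|s| <= T -> `|c0 s| <= C) -> `|t| <= T ->
  `|coef c0 n t| <= C * (`|t| ^+ n / n`!%:R).
Proof.
move=> cc c0C; elim: n t => [|n IH] t tT.
  by rewrite expr0 fact0 divr1 mulr1 c0C.
by rewrite /= normrN; apply: primitive_pow_bound tT => //; exact: continuous_coef.
Qed.

Lemma limn_series_recl (u : nat -> V) : cvgn (series u) ->
  cvgn (series (fun n => u n.+1)) /\
  limn (series u) = u 0%N + limn (series (fun n => u n.+1)).
Proof.
move=> cu.
have E : series (fun n => u n.+1) = (fun n => series u n.+1 - u 0%N).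
  apply/funext => n; rewrite /series/= big_nat_recl// addrAC subrr add0r.
  by [].
have : series (fun n => u n.+1) @ \oo --> limn (series u) - u 0%N.
  rewrite E; apply: cvgB; last exact: cvg_cst.
  have := cvg_shiftS (series u) (nbhs (limn (series u))).
  by move=> ->.
move=> h; split; first by apply/cvg_ex; eexists; exact: h.
by rewrite (cvg_lim _ h)// addrC subrK.
Qed.

(** On |s| <= T the n-th term of the series of the c_n(s) B^n x is bounded by
    that of a multiple of the series of exp (T L), with L a bound of B.  Hence
    the series may be differentiated termwise, and the derivative of its n-th
    term, for n > 0, is the image of the preceding term under -B. *)
Lemma linear_ode_solution (B : {linear V -> V}) (c0 g : R -> R) (x : V) :
  bounded_operator B -> (forall t : R, is_derive t 1 c0 (g t)) ->
  exists U : R -> V, U 0 = c0 0 *: x /\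
    forall t : R, is_derive t 1 U (g t *: x - B (U t)).
Proof.
move=> B_bounded c0'.
have cB : continuous B := bounded_operator_continuous B_bounded.
have cc0 : continuous c0 by move=> t; exact: is_derive_continuous (c0' t).
have [L L0 BL] : exists2 L : R, 0 <= L & forall z, `|B z| <= L * `|z|.
  case: B_bounded => M BM; exists `|M| => // z.
  by apply: le_trans (BM z) _; rewrite ler_wpM2r// ler_norm.
pose c n := coef c0 n.
pose xs n := iter n B x.
have xsL n : `|xs n| <= L ^+ n * `|x|.
  elim: n => [|n IH]; first by rewrite expr0 mul1r.
  by rewrite exprS -mulrA; apply: le_trans (BL _) _; rewrite ler_wpM2l.
have majorant (T : R) : 0 <= T -> exists m : nat -> R, cvgn (series m) /\
    forall n s, `|s| <= T -> `|c n s| * `|xs n| <= m n.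
  move=> T0.
  have [||s0 _ s0max] := @EVT_max R (fun s => `|c0 s|) (- T) T.
  - by rewrite ge0_cp.
  - by apply: continuous_subspaceT => s; apply: cvg_norm; exact: cc0.
  exists (fun n => `|c0 s0| * `|x| * exp_coeff (T * L) n); split.
    exact: is_cvg_seriesZ (is_cvg_series_exp_coeff _).
  move=> n s sT.
  have c0C u : `|u| <= T -> `|c0 u| <= `|c0 s0|.
    by move=> uT; apply: s0max; rewrite in_itv/= -ler_norml.
  apply: le_trans (ler_pM _ _ (coef_bound n cc0 c0C sT) (xsL n)) _ => //.
  have sTn : `|s| ^+ n <= T ^+ n by apply: lerXn2r; rewrite ?nnegrE.
  have q0 : 0 <= n`!%:R^-1 :> R by rewrite invr_ge0.
  rewrite /exp_coeff/= exprMn; move: n`!%:R^-1 q0 => q q0.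
  rewrite -subr_ge0 (_ : _ - _ = `|c0 s0| * `|x| * q * L ^+ n * (T ^+ n - `|s| ^+ n));
    last by ring.
  by rewrite !mulr_ge0// ?exprn_ge0// subr_ge0.
have cvgU s : cvgn (series (fun n => c n s *: xs n)).
  have [m [cm cxm]] := majorant `|s| (normr_ge0 s).
  apply: normed_cvg; apply: series_le_cvg cm => //= n.
    by apply: le_trans (cxm n s _); rewrite ?mulr_ge0.
  by rewrite normrZ cxm.
pose U s := limn (series (fun n => c n s *: xs n)).
pose W s := limn (series (fun n => c n.+1 s *: xs n.+1)).
have UE s : U s = c0 s *: x + W s by have [_] := limn_series_recl (cvgU s).
have W0 : W 0 = 0.
  rewrite /W (_ : series _ = cst 0) ?lim_cst//.
  apply/funext => n; rewrite /series/= big1// => k _.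
  by rewrite primitive0 oppr0 scale0r.
exists U; split=> [|t]; first by rewrite UE W0 addr0.
have [m [cm cxm]] := majorant (`|t| + 1) (addr_ge0 (normr_ge0 t) ler01).
have dW : is_derive t 1 W (limn (series (fun n => - c n t *: xs n.+1))).
  apply: (@is_derive_series _ _ (fun n => c n.+1) (fun n s => - c n s)
     (fun n => xs n.+1) (fun n => L * m n) (`|t| + 1)).
  - by rewrite ltrDl.
  - move=> n s _; apply: is_deriveN; apply: is_derive_primitive.
    exact: continuous_coef.
  - move=> n s sT; rewrite normrN; apply: le_trans (ler_wpM2l (normr_ge0 _) (BL _)) _.
    by rewrite mulrCA ler_wpM2l// cxm// ltW.
  - exact: is_cvg_seriesZ.
  - by move=> s _; have [] := limn_series_recl (cvgU s).
have -> : g t *: x - B (U t) =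
    (g t *: x + c0 t *: 0) + limn (series (fun n => - c n t *: xs n.+1)).
  rewrite scaler0 addr0; congr (_ + _); apply/esym/cvg_lim => //.
  rewrite (_ : series _ = (fun n => - B (series (fun n => c n t *: xs n) n))).
    by apply: cvgN; apply: continuous_cvg; [exact: cB|exact: cvgU].
  apply/funext => n; rewrite /series/= linear_sum -sumrN.
  by apply: eq_bigr => k _; rewrite linearZ scaleNr.
have -> : U = (fun s => c0 s *: x) + W by apply/funext.
apply: is_deriveD => //; apply: is_derive_scale => //; exact: is_derive_cst.
Qed.

End LinearODE.

(** * Comparison and energy estimates *)

Section Comparison.
Context {R : realType}.

(** Gronwall's inequality in differential form: expR (G t) is the integrating
    factor of phi' + g phi <= 0. *)
Lemma exp_weighted_nincr (phi dphi G g : R -> R) (a b : R) : a <= b ->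
  {within `[a, b], continuous phi} -> {within `[a, b], continuous G} ->
  (forall t : R, a < t < b -> is_derive t 1 phi (dphi t)) ->
  (forall t : R, a < t < b -> is_derive t 1 G (g t)) ->
  (forall t : R, a < t < b -> dphi t + g t * phi t <= 0) ->
  expR (G b) * phi b <= expR (G a) * phi a.
Proof.
move=> ab cphi cG phi' G' le0.
pose f (t : R) := expR (G t) * phi t.
have f' t : a < t < b -> is_derive t 1 f (expR (G t) * (dphi t + g t * phi t)).
  move=> tab; have eG : is_derive t 1 (expR \o G) (expR (G t) * g t).
    by apply: is_derive1_comp; exact: G'.
  have -> : expR (G t) * (dphi t + g t * phi t) =
      (expR (G t) * g t) *: phi t + expR (G t) *: dphi t.
    by rewrite -[_ *: phi t]/(_ * _) -[_ *: dphi t]/(_ * _); ring.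
  exact: is_derive_scale eG (phi' t tab).
apply: (@ler0_derive1_nincr _ f a b) => //.
- by move=> t; rewrite in_itv/= => /f' [].
- move=> t; rewrite in_itv/= => tab; rewrite derive1E; have [_ ->] := f' t tab.
  by rewrite pmulr_rle0 ?expR_gt0// le0.
- move=> t; apply: cvgM; last exact: cphi.
  by apply: continuous_comp; [exact: cG|exact: continuous_expR].
Qed.

Lemma nonneg_derive_nondecreasing (F f : R -> R) :
  (forall t : R, is_derive t 1 F (f t)) -> (forall t, 0 <= f t) -> {homo F : x y / x <= y}.
Proof.
move=> F' f0 x y xy; apply: (@ger0_derive1_ndecr _ F x y) => //.
- by move=> t _; rewrite derive1E; have [_ ->] := F' t; rewrite ?f0.
- by apply: continuous_subspaceT => t; exact: is_derive_continuous (F' t).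
Qed.

(** A bounded nondecreasing primitive would converge, and the fundamental
    theorem on the half-line would make the integral finite. *)
Lemma primitive_cvg_pinfty (f : R -> R) : continuous f -> (forall t, 0 <= f t) ->
  (\int[lebesgue_measure]_(s in `[0%R, +oo[) (f s)%:E = +oo)%E ->
  primitive f t @[t --> +oo] --> +oo.
Proof.
move=> cf f0 f_int.
have F' t := is_derive_primitive t cf.
have Fmono : {homo primitive f : x y / x <= y} := nonneg_derive_nondecreasing F' f0.
apply/cvgryPge => M.
have [[t0 Mt0]|/forallNP noM] := pselect (exists t, M <= primitive f t).
  near=> t; apply: le_trans Mt0 (Fmono _ _ _).
  by near: t; apply: nbhs_pinfty_ge; rewrite num_real.
have Fub : has_ubound (range (primitive f)).
  by exists M => _ [t _ <-]; have /negP := noM t; rewrite -ltNge => /ltW.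
exfalso; have : (+oo = (sup (range (primitive f)))%:E - (primitive f 0)%:E)%E.
  rewrite -f_int; apply: ge0_continuous_FTC2y => //.
  - exact: continuous_subspaceT.
  - exact: nondecreasing_cvgr.
  - by apply: cvg_at_right_filter; exact: continuous_primitive.
  - by move=> t _; rewrite derive1E; have [_ ->] := F' t.
by [].
Unshelve. all: by end_near. Qed.

End Comparison.

Section EnergyEstimates.
Context {R : realType} {H : completeNormedModType R} {dot : {dot H for idfun}}.
Hypothesis dot_norm : induces_norm dot.
Context {A : {linear H -> H}}.
Hypothesis A_bounded : bounded_operator A.
Context {eps : R -> R}.
Hypothesis eps_gt0 : forall t : R, 0 <= t -> 0 < eps t.
Hypothesis eps_decr : forall s t : R, 0 <= s -> s <= t -> eps t <= eps s.

Local Notation Ast := (adjoint dot A).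

Lemma is_derive_sqnorm (u : R -> H) (t : R) (d : H) : is_derive t 1 u d ->
  is_derive t 1 (fun s => `|u s| ^+ 2) (2 * dot (u t) d).
Proof.
move=> u'; apply/is_deriveP.
have -> : (fun h => h^-1 *: (`|u (t + h)| ^+ 2 - `|u t| ^+ 2)) =
    (fun h => dot (u (t + h) + u t) (h^-1 *: (u (t + h) - u t))).
  apply/funext => h; rewrite dotZr -[LHS]/(_ * _); congr (_ * _).
  rewrite -!dot_norm !(dotDl, dotDr, dotNr) (dotC (u t) (u (t + h))); ring.
have -> : 2 * dot (u t) d = dot (u t + u t) d by rewrite dotDl; ring.
apply: (cvg_dot dot_norm); last exact/is_deriveP.
by apply: cvgD; [exact: is_derive_cvg_shift u'|exact: cvg_cst].
Qed.

Lemma within_continuous_sqnorm (D : set R) (u : R -> H) :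
  {within D, continuous u} -> {within D, continuous (fun s => `|u s| ^+ 2)}.
Proof.
move=> cu t; under eq_fun do rewrite expr2.
by apply: cvgM; apply: cvg_norm; exact: cu.
Qed.

(** On [0, t], eps is at least k := eps t, and Young's inequality with weight 1
    absorbs <A w, e> in |A w|^2; hence |w|^2 - |e|^2 / (4 k), multiplied by
    exp (2 k s), is nonincreasing in s, and it is not positive at s = 0. *)
Lemma noise_estimate (w : R -> H) (e : H) :
  {within `[0, +oo[, continuous w} -> w 0 = 0 ->
  (forall t : R, 0 < t ->
     is_derive t 1 w (- (Ast (A (w t)) + eps t *: w t) + Ast e)) ->
  forall t, 0 <= t -> 4 * eps t * `|w t| ^+ 2 <= `|e| ^+ 2.
Proof.
move=> cw w0 w' t; rewrite le_eqVlt => /predU1P[<-|t0].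
  by rewrite w0 normr0 expr0n/= mulr0 sqr_ge0.
pose k := eps t; have k0 : 0 < k := eps_gt0 (ltW t0).
pose phi s := `|w s| ^+ 2 - `|e| ^+ 2 / (4 * k).
pose dphi s := 2 * dot (w s) (- (Ast (A (w s)) + eps s *: w s) + Ast e).
have := @exp_weighted_nincr _ phi dphi (fun s => 2 * k * s) (fun=> 2 * k) 0 t (ltW t0).
rewrite /phi w0 normr0 expr0n/= mulr0 expR0 mul1r sub0r => main.
have {main} : expR (2 * k * t) * (`|w t| ^+ 2 - `|e| ^+ 2 / (4 * k)) <= 0.
  apply: le_trans (main _ _ _ _ _) _.
  - move=> s; apply: cvgB; last exact: cvg_cst.
    apply: within_continuous_sqnorm.
    by apply: continuous_subspaceW cw; exact: subset_itvl.
  - by apply: continuous_subspaceT => s; apply: cvgM; [exact: cvg_cst|exact: cvg_id].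
  - move=> s /andP[s0 _]; rewrite -[dphi s]subr0.
    by apply: is_deriveB; exact: is_derive_sqnorm (w' s s0).
  - move=> s _; rewrite -[X in is_derive _ _ _ X]mulr1.
    exact: is_deriveZ (is_derive_id _ _).
  - move=> s /andP[s0 st].
    have ke : k <= eps s by exact: eps_decr (ltW s0) (ltW st).
    rewrite /dphi !(dotDr, dotNr, dotZr) -!(adjointP dot_norm A_bounded) !dot_norm.
    have young := le_dot dot_norm (A (w s)) e ltr01.
    have kw : k * `|w s| ^+ 2 <= eps s * `|w s| ^+ 2 by rewrite ler_wpM2r// sqr_ge0.
    have -> : 2 * k * (`|w s| ^+ 2 - `|e| ^+ 2 / (4 * k)) =
        2 * (k * `|w s| ^+ 2) - `|e| ^+ 2 / 2 by field; rewrite gt_eqF.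
    by lra.
  - by rewrite oppr_le0 divr_ge0 ?sqr_ge0// mulr_ge0// ltW.
rewrite pmulr_rle0 ?expR_gt0// subr_le0 ler_pdivlMr ?mulr_gt0//.
by rewrite mulrC.
Qed.

(** For y = A^* (A z) + r the forcing -eps y contributes -eps <A v, A z>, absorbed
    by |A v|^2 at the cost of eps^2 |A z|^2 / 4, and -eps <v, r>.  Once
    eps |A z|^2 is small, this makes exp (E t) (|v|^2 - 2 eta2) nonincreasing,
    where eta2 bounds |r|^2; then divergence of E concludes. *)
Lemma regularized_error_cvg0 (v : R -> H) (y : H) (E : R -> R) :
  (forall x, A x = 0 -> dot y x = 0) ->
  {within `[0, +oo[, continuous v} ->
  (forall t : R, 0 < t ->
     is_derive t 1 v (- (Ast (A (v t)) + eps t *: v t) - eps t *: y)) ->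
  (forall t : R, 0 < t -> is_derive t 1 E (eps t)) ->
  eps t @[t --> +oo] --> 0 -> E t @[t --> +oo] --> +oo ->
  v t @[t --> +oo] --> 0.
Proof.
move=> y_orth cv v' E' eps0 Einf; apply/cvgr0Pnorm_lt => e e0.
have [z] := approx_by_range_of_normal_operator dot_norm A_bounded y_orth
  (divr_gt0 e0 (ltr0n _ 2)).
set r := y - Ast (A z) => re.
have yE : y = Ast (A z) + r by rewrite /r addrC subrK.
clearbody r.
pose eta2 := e ^+ 2 / 4; have eta20 : 0 < eta2 by rewrite divr_gt0// exprn_gt0.
have r2 : `|r| ^+ 2 <= eta2.
  have -> : eta2 = (e / 2) ^+ 2 by rewrite /eta2; field.
  have e2 : 0 <= e / 2 by rewrite divr_ge0// ltW.
  by rewrite ler_pXn2r ?nnegrE// ltW.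
pose c := `|A z| ^+ 2.
have [T [T0 Tc]] : exists T, 0 < T /\ forall t, T <= t -> eps t * c <= 2 * eta2.
  have : eps t * c @[t --> +oo] --> 0 * c by apply: cvgM => //; exact: cvg_cst.
  rewrite mul0r => /cvgr_le /(_ _ (mulr_gt0 (ltr0n R 2) eta20)) [T [_ TP]].
  exists (Num.max T 0 + 1); split=> [|t Tt]; first by rewrite ltr_wpDl// le_max lexx orbT.
  by apply: TP; apply: lt_le_trans Tt; rewrite ltr_pwDr// le_max lexx.
pose phi t := `|v t| ^+ 2 - 2 * eta2.
pose dphi t := 2 * dot (v t) (- (Ast (A (v t)) + eps t *: v t) - eps t *: y).
have decay t : T <= t -> expR (E t) * phi t <= expR (E T) * phi T.
  move=> Tt; apply: (@exp_weighted_nincr _ phi dphi E eps) => //.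
  - move=> s; apply: cvgB; last exact: cvg_cst.
    apply: within_continuous_sqnorm; apply: continuous_subspaceW cv.
    by apply: subset_itv; rewrite bnd_simp// ltW.
  - apply: derivable_within_continuous => s; rewrite in_itv/= => /andP[Ts _].
    by have [] := E' s (lt_le_trans T0 Ts).
  - move=> s /andP[Ts _]; rewrite -[dphi s]subr0.
    apply: is_deriveB.
    exact: is_derive_sqnorm (v' s (lt_trans T0 Ts)).
  - by move=> s /andP[Ts _]; apply: E' (lt_trans T0 Ts).
  - move=> s /andP[Ts _].
    have es0 : 0 < eps s by apply: eps_gt0; apply: ltW; exact: lt_trans Ts.
    rewrite /dphi yE scalerDr opprD !(dotDr, dotNr, dotZr).
    rewrite -!(adjointP dot_norm A_bounded) !dot_norm.
    have young1 := le_dot dot_norm (A (v s)) (- eps s *: A z) ltr01.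
    have half0 : 0 < 2^-1 :> R by rewrite invr_gt0.
    have young2 := le_dot dot_norm (v s) (- r) half0.
    rewrite dotZr normrZ exprMn real_normK ?num_real// sqrrN -/c in young1.
    rewrite dotNr normrN (_ : 4 * 2^-1 = 2 :> R) in young2; last by field.
    have epsc := ler_wpM2l (ltW es0) (Tc s (ltW Ts)).
    have epsr := ler_wpM2l (ltW es0) r2.
    have eps_young2 := ler_wpM2l (ltW es0) young2.
    rewrite /phi; lra.
near=> t.
have Tt : T <= t by near: t; apply: nbhs_pinfty_ge; rewrite num_real.
have small : expR (- E t) * (expR (E T) * `|phi T|) < eta2.
  near: t.
  have : expR (- E t) * (expR (E T) * `|phi T|) @[t --> +oo] --> 0 * (expR (E T) * `|phi T|).
    by apply: cvgM; [exact: (cvg_comp _ _ Einf (@cvgr_expR R))|exact: cvg_cst].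
  by rewrite mul0r => /cvgr_lt; apply.
have phit : phi t < eta2.
  apply: le_lt_trans small; rewrite -[leLHS]mul1r -(expRxMexpNx_1 (E t)).
  rewrite [_ * expR (- _)]mulrC -mulrA ler_pM2l ?expR_gt0//.
  apply: le_trans (decay t Tt) _; rewrite ler_pM2l ?expR_gt0//; exact: ler_norm.
rewrite -(@ltr_pXn2r _ 2)// ?nnegrE ?(ltW e0)//.
have := exprn_gt0 2 e0; move: phit; rewrite /phi /eta2.
by move: (`|v t| ^+ 2) (e ^+ 2) => a b; lra.
Unshelve. all: by end_near. Qed.

End EnergyEstimates.

(** * The regularized flow *)

Section RegularizedFlow.
Context {R : realType} {H : completeNormedModType R} {dot : {dot H for idfun}}.
Hypothesis dot_norm : induces_norm dot.
Context {A : {linear H -> H}}.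
Hypothesis A_bounded : bounded_operator A.
Context {eps : R -> R}.
Hypothesis eps_gt0 : forall t : R, 0 <= t -> 0 < eps t.
Hypothesis eps_cont : {within `[0, +oo[%classic, continuous eps}.
Hypothesis eps_decr : forall s t : R, 0 <= s -> s <= t -> eps t <= eps s.

Local Notation Ast := (adjoint dot A).

(** Extended to a continuous function on the whole line, eps leads to a
    solution with two-sided derivatives, also at time 0. *)
Definition eps_ext (t : R) : R := eps (Num.max t 0).

Lemma eps_extE (t : R) : 0 <= t -> eps_ext t = eps t.
Proof. by move=> t0; rewrite /eps_ext max_l. Qed.

Lemma eps_ext_ge0 (t : R) : 0 <= eps_ext t.
Proof. by apply/ltW/eps_gt0; rewrite le_max lexx orbT. Qed.

Lemma continuous_eps_ext : continuous eps_ext.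
Proof.
have max_ge0 (x : R) : `[0, +oo[%classic (Num.max x 0).
  by rewrite /= in_itv/= andbT le_max lexx orbT.
move=> t; move/subspace_continuousP : eps_cont => /(_ _ (max_ge0 t)) ct.
apply: cvg_comp ct => P /= [e e0 eP].
have cm : Num.max x 0 @[x --> t] --> Num.max t 0.
  by apply: continuous_max; [exact: cvg_id|exact: cvg_cst].
apply: (@filterS _ (nbhs t) _ _ _ _ (cm _ (nbhsx_ballx _ _ e0))) => x xe.
by apply: eP (max_ge0 x).
Qed.

(** The one-sided derivative at 0 is what yields continuity there, hence
    comparison arguments that start from the initial value. *)
Lemma global_solution_continuous (F : R -> H -> H) (u0 : H) (u : R -> H) :
  global_solution F u0 u -> {within `[0, +oo[, continuous u}.
Proof.
move=> [_ right_der u']; apply/continuous_within_itvcyP; split.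
  by move=> t; rewrite in_itv/= andbT => /u' /is_derive_continuous.
have hu : u 0 + h *: (h^-1 *: (u h - u 0)) @[h --> 0^'+] --> u 0 + 0 *: F 0 (u 0).
  apply: cvgD; first exact: cvg_cst.
  by apply: cvgZ => //; exact: cvg_at_right_filter.
rewrite scale0r addr0 in hu; apply: cvg_trans hu.
apply: near_eq_cvg; near=> h; have h0 : 0 < h by near: h; exact: nbhs_right_gt.
by rewrite /= scalerA divff ?gt_eqF// scale1r addrC subrK.
Unshelve. all: by end_near. Qed.

Lemma regularized_flow_global_solution (g u0 : H) :
  exists u, global_solution (regularized_flow dot A eps g) u0 u.
Proof.
pose B : {linear H -> H} := HB.pack (fun x => Ast (A x))
  (GRing.isLinear.Build R H H _ (fun x => Ast (A x))
    (fun a x z => etrans (congr1 Ast (linearP A a x z))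
                         (adjoint_linear dot_norm A_bounded a (A x) (A z)))).
have B_bounded : bounded_operator B.
  have [M AM] := A_bounded; have [N AN] := adjoint_bounded dot_norm A_bounded.
  exists (`|N| * M) => x; apply: le_trans (AN (A x)) _.
  apply: le_trans (ler_wpM2r (normr_ge0 _) (ler_norm N)) _.
  by rewrite -mulrA ler_wpM2l.
pose E := primitive eps_ext.
have E' (t : R) : is_derive t 1 E (eps_ext t) := is_derive_primitive t continuous_eps_ext.
have c1 (t : R) : is_derive t 1 (cst (1 : R)) (0 : R) by exact: is_derive_cst.
have ceE : continuous (expR \o E).
  move=> t; apply: continuous_comp; last exact: continuous_expR.
  exact: is_derive_continuous (E' t).
have [U1 [U10 U1']] := linear_ode_solution u0 B_bounded c1.
have [U2 [U20 U2']] := linear_ode_solution (Ast g) B_bounded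
  (fun t => is_derive_primitive t ceE).
(* Multiplied by exp E, the flow reads U' = expR (E t) *: Ast g - B U: U1 carries
   the initial value and U2 the source term. *)
pose u (t : R) := expR (- E t) *: (U1 t + U2 t).
have u_0 : u 0 = u0.
  by rewrite /u /E primitive0 oppr0 expR0 scale1r U10 U20 primitive0 scale0r addr0 scale1r.
have u' (t : R) : is_derive t 1 u (- (Ast (A (u t)) + eps_ext t *: u t - Ast g)).
  have e' : is_derive t 1 (fun s => expR (- E s)) (expR (- E t) * - eps_ext t).
    by apply: (@is_derive1_comp _ expR (- E)); exact: is_deriveN.
  have BuE : B (u t) = expR (- E t) *: (B (U1 t) + B (U2 t)).
    by rewrite linearZ; congr (_ *: _); exact: linearD.
  have := is_derive_scale e' (is_deriveD (U1' t) (U2' t)).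
  congr is_derive; rewrite -[Ast (A (u t))]/(B (u t)) BuE /u.
  rewrite scale0r sub0r/=; apply: (dot_inj dot_norm) => x.
  rewrite !(dotDr, dotNr, dotZr) /cst.
  set a := dot x (U1 t); set b := dot x (U2 t). ring: (expRxMexpNx_1 (E t)).
exists u; split=> //.
  have := u' 0; rewrite u_0 eps_extE// => /is_deriveP.
  by move=> /cvg_dnbhs_at_right; under eq_fun do rewrite add0r u_0.
by move=> t t0; have := u' t; rewrite eps_extE// ltW.
Qed.

Lemma regularized_flow_stability (g1 g2 u0 : H) (u1 u2 : R -> H) :
  global_solution (regularized_flow dot A eps g1) u0 u1 ->
  global_solution (regularized_flow dot A eps g2) u0 u2 ->
  forall t, 0 <= t -> 4 * eps t * `|u1 t - u2 t| ^+ 2 <= `|g1 - g2| ^+ 2.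
Proof.
move=> s1 s2; apply: (noise_estimate dot_norm A_bounded eps_gt0 eps_decr).
- move=> t; apply: cvgB; [exact: global_solution_continuous s1 t|
    exact: global_solution_continuous s2 t].
- by case: s1 s2 => -> _ _ [-> _ _]; rewrite subrr.
move=> t t0; case: s1 s2 => _ _ /(_ t t0) u1' [_ _ /(_ t t0) u2'].
have := is_deriveB u1' u2'; congr is_derive.
rewrite /regularized_flow (linearB A) !(adjointB dot_norm A_bounded) scalerBr.
by apply: (dot_inj dot_norm) => x; rewrite !(dotDr, dotNr, dotZr); ring.
Qed.

(** The stability estimate for equal data. *)
Lemma regularized_flow_unique (g u0 : H) (u : R -> H) :
  global_solution (regularized_flow dot A eps g) u0 u ->
  unique_global_solution (regularized_flow dot A eps g) u0 u.
Proof.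
move=> su; split=> // v sv t t0.
have := regularized_flow_stability sv su t0; rewrite subrr normr0 expr0n/=.
rewrite pmulr_rle0 ?mulr_gt0 ?eps_gt0// => h.
have : `|v t - u t| ^+ 2 == 0 by rewrite eq_le h sqr_ge0.
by rewrite expf_eq0/= normr_eq0 subr_eq0 => /eqP.
Qed.

Lemma regularized_flow_cvg (y u0 : H) (u : R -> H) :
  (forall x, A x = 0 -> dot y x = 0) ->
  eps t @[t --> +oo] --> (0 : R) ->
  (\int[lebesgue_measure]_(s in `[0%R, +oo[) (eps s)%:E = +oo)%E ->
  global_solution (regularized_flow dot A eps (A y)) u0 u ->
  u t @[t --> +oo] --> y.
Proof.
move=> y_orth eps_lim eps_int su.
have v0 : u t - y @[t --> +oo] --> 0.
  apply: (@regularized_error_cvg0 _ _ _ dot_norm _ A_bounded _ eps_gt0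
    (fun t => u t - y) y (primitive eps_ext)) => //.
  - move=> t; apply: cvgB; last exact: cvg_cst.
    exact: global_solution_continuous su _.
  - move=> t t0; case: su => _ _ /(_ t t0) u'.
    have := is_deriveB u' (is_derive_cst y t 1); congr is_derive.
    rewrite /regularized_flow (linearB A) !(adjointB dot_norm A_bounded).
    by apply: (dot_inj dot_norm) => x; rewrite !(dotDr, dotNr, dotZr) linear0r; ring.
  - move=> t t0; rewrite -eps_extE ?ltW//.
    exact: is_derive_primitive continuous_eps_ext.
  - apply: primitive_cvg_pinfty; [exact: continuous_eps_ext|exact: eps_ext_ge0|].
    rewrite -eps_int; apply: eq_integral => t.
    by rewrite inE/= in_itv/= andbT => t0; rewrite eps_extE.
by apply: cvg_zero; exact: v0.
Qed.

End RegularizedFlow.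

(** * A priori stopping rules *)

Section AprioriStopping.
Context {R : realType} {eps : R -> R}.
Hypothesis eps_gt0 : forall t : R, 0 <= t -> 0 < eps t.
Hypothesis eps_decr : forall s t : R, 0 <= s -> s <= t -> eps t <= eps s.

Let powR_scaled_cvg0 (c a : R) : 0 < a -> c * d `^ a @[d --> 0^'+] --> 0.
Proof.
by move=> a0; rewrite -[X in _ --> X](mulr0 c); apply: cvgMr; exact: powR_cvg0.
Qed.

Lemma stopping_time_exists (c a : R) : 0 < c -> 0 < a ->
  {within `[0, +oo[%classic, continuous eps} -> eps t @[t --> +oo] --> (0 : R) ->
  \forall d \near 0^'+, exists t, 0 <= t /\ eps t = c * d `^ a.
Proof.
move=> c0 a0 eps_cont eps_lim; near=> d.
have d0 : 0 < d by near: d; exact: nbhs_right_gt.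
have v0 : 0 < c * d `^ a by rewrite mulr_gt0// powR_gt0.
have v1 : c * d `^ a < eps 0.
  by near: d; move/cvgr_lt : (powR_scaled_cvg0 c a0); apply; exact: eps_gt0.
have [T T0 Tv] : exists2 T, 0 <= T & eps T < c * d `^ a.
  move/cvgr_lt : eps_lim => /(_ _ v0) [T [_ TP]].
  exists (Num.max T 0 + 1); first by rewrite addr_ge0// le_max lexx orbT.
  by apply: TP; rewrite ltr_pwDr// le_max lexx.
have [||t] := @IVT R eps 0 T (c * d `^ a) T0.
- by apply: continuous_subspaceW eps_cont; exact: subset_itvl.
- by rewrite ge_min le_max (ltW Tv) (ltW v1) orbT.
by rewrite in_itv/= => /andP[t0 _] te; exists t.
Unshelve. all: by end_near. Qed.

(** Both error terms vanish: as eps is nonincreasing and positive, the root td d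
    exceeds any given time once d is small, so that u (td d) is close to y, and
    the noise term is bounded by d^2 / (4 eps (td d)) = d^(2 - a) / (4 c). *)
Lemma stopping_time_error_cvg0 (H : completeNormedModType R) (y : H)
    (u : R -> H) (ud : R -> R -> H) (td : R -> R) (c a : R) :
  u t @[t --> +oo] --> y ->
  (forall d t, 0 < d -> 0 <= t -> 4 * eps t * `|ud d t - u t| ^+ 2 <= d ^+ 2) ->
  0 < c -> 0 < a < 2 ->
  (\forall d \near 0^'+, 0 <= td d /\ eps (td d) = c * d `^ a) ->
  `|ud d (td d) - y| @[d --> 0^'+] --> (0 : R).
Proof.
move=> uy stable c0 /andP[a0 a2] tdP; apply/cvgr0Pnorm_lt => e e0.
have e2 : 0 < e / 2 by rewrite divr_gt0.
have a20 : 0 < 2 - a by rewrite subr_gt0.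
have [T [T0 Ty]] : exists T, 0 <= T /\ forall t, T < t -> `|y - u t| < e / 2.
  move/cvgr_dist_lt : uy => /(_ _ e2) [T [_ TP]].
  exists (Num.max T 0); split=> [|t]; first by rewrite le_max lexx orbT.
  by rewrite gt_max => /andP[Tt _]; exact: TP.
near=> d.
have d0 : 0 < d by near: d; exact: nbhs_right_gt.
have [td0 tde] : 0 <= td d /\ eps (td d) = c * d `^ a by near: d.
have Ttd : T < td d.
  rewrite ltNge; apply/negP => /(eps_decr td0); rewrite tde leNgt => /negP; apply.
  by near: d; move/cvgr_lt : (powR_scaled_cvg0 c a0); apply; exact: eps_gt0.
have noise : `|ud d (td d) - u (td d)| < e / 2.
  rewrite -(@ltr_pXn2r _ 2)// ?nnegrE ?(ltW e2)//.
  have K0 : 0 < 4 * (c * d `^ a) by rewrite !mulr_gt0// powR_gt0.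
  rewrite -(ltr_pM2l K0); apply: le_lt_trans; first by rewrite -tde; exact: stable.
  have -> : d ^+ 2 = d `^ (2 - a) * d `^ a.
    by rewrite -powR_mulrn ?ltW// -powRD ?subrK// (gt_eqF d0) implybT.
  rewrite -subr_gt0.
  have -> : 4 * (c * d `^ a) * (e / 2) ^+ 2 - d `^ (2 - a) * d `^ a =
     d `^ a * (4 * c * (e / 2) ^+ 2 - 1 * d `^ (2 - a)) by ring.
  rewrite mulr_gt0 ?powR_gt0// subr_gt0.
  near: d; move/cvgr_lt : (powR_scaled_cvg0 1 a20); apply.
  by rewrite !mulr_gt0// exprn_gt0.
rewrite normr_id -(subrK (u (td d)) (ud d (td d))) -addrA.
apply: le_lt_trans (ler_normD _ _) _; rewrite [ltRHS](splitr e) ltrD//.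
by rewrite distrC; exact: Ty.
Unshelve. all: by end_near. Qed.

End AprioriStopping.

Theorem theorem3p1 (R : realType) (H : completeNormedModType R)
    (dot : {dot H for idfun}) (dot_norm : induces_norm dot)
    (A : {linear H -> H}) (A_bounded : bounded_operator A)
    (A_range : ~ closed (range A))
    (f y : H) (Ay : A y = f)
    (y_orth : forall x : H, A x = 0 -> dot y x = 0)
    (eps : R -> R)
    (eps_gt0 : forall t : R, 0 <= t -> 0 < eps t)
    (eps_cont : {within `[0, +oo[%classic, continuous eps})
    (eps_decr : forall s t : R, 0 <= s -> s <= t -> eps t <= eps s)
    (eps_lim : eps t @[t --> +oo] --> (0 : R))
    (eps_int : (\int[lebesgue_measure]_(s in `[0%R, +oo[) (eps s)%:E = +oo)%E)
    (u0 : H) :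
  (exists u : R -> H,
     [/\ unique_global_solution (regularized_flow dot A eps f) u0 u,
         cvg (u t @[t --> +oo]),
         A (lim (u t @[t --> +oo])) = f &
         lim (u t @[t --> +oo]) = y])
  /\
  (forall fd : R -> H,
     (forall delta : R, 0 < delta -> `|fd delta - f| <= delta) ->
     exists ud : R -> R -> H,
       [/\ forall delta : R, 0 < delta ->
             unique_global_solution (regularized_flow dot A eps (fd delta)) u0
               (ud delta),
           exists td : R -> R,
             (forall delta : R, 0 < delta -> 0 <= td delta) /\
             `|ud delta (td delta) - y| @[delta --> 0^'+] --> (0 : R),
           forall b : R, 0 < b < 1 ->
             (\forall delta \near 0^'+,
                exists t : R, 0 <= t /\ eps t = delta `^ b) /\
             (forall td : R -> R,
                (\forall delta \near 0^'+,
                   0 <= td delta /\ eps (td delta) = delta `^ b) ->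
                `|ud delta (td delta) - y| @[delta --> 0^'+] --> (0 : R)) &
           forall b : R, 0 < b < 1 ->
             (\forall delta \near 0^'+,
                exists t : R, 0 <= t /\ 2 * Num.sqrt (eps t) = delta `^ b) /\
             (forall td : R -> R,
                (\forall delta \near 0^'+,
                   0 <= td delta /\
                   2 * Num.sqrt (eps (td delta)) = delta `^ b) ->
                `|ud delta (td delta) - y| @[delta --> 0^'+] --> (0 : R))]).
Proof.
have sol g : exists u, unique_global_solution (regularized_flow dot A eps g) u0 u.
  have [u su] := regularized_flow_global_solution dot_norm A_bounded eps_cont g u0.
  by exists u; apply/(regularized_flow_unique dot_norm A_bounded eps_gt0 eps_decr).
have [u uP] := sol f; have su := uP.1.
have uy : u t @[t --> +oo] --> y.
  apply: (regularized_flow_cvg dot_norm A_bounded eps_gt0 eps_cont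
    y_orth eps_lim eps_int (u0 := u0)).
  by rewrite Ay.
have limu : lim (u t @[t --> +oo]) = y by apply: cvg_lim uy; exact: norm_hausdorff.
split; first by exists u; split; rewrite ?limu//; apply/cvg_ex; exists y.
move=> fd fdP; have [ud udP] := choice (fun d => sol (fd d)).
have stable d t : 0 < d -> 0 <= t -> 4 * eps t * `|ud d t - u t| ^+ 2 <= d ^+ 2.
  move=> d0 t0.
  apply: le_trans (regularized_flow_stability dot_norm A_bounded
    eps_gt0 eps_decr (udP d).1 su t0) _.
  by rewrite ler_pXn2r// ?nnegrE ?fdP// ltW.
have rule td c a := @stopping_time_error_cvg0 R eps eps_gt0 eps_decr H y u ud td c a uy stable.
have root c a (c0 : 0 < c) (a0 : 0 < a) := stopping_time_exists eps_gt0 c0 a0 eps_cont eps_lim.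
(* This brings the second stopping rule to the form eps t = c d^a, with a < 2. *)
have sqrt_rule b d t : 0 <= t -> 0 < d ->
    2 * Num.sqrt (eps t) = d `^ b <-> eps t = 4^-1 * d `^ (b * 2).
  move=> t0 d0; have p0 : 0 <= d `^ b by exact: powR_ge0.
  rewrite powRrM powR_mulrn//; split=> [<-|->].
    by rewrite exprMn sqr_sqrtr ?ltW ?eps_gt0//; field.
  have -> : 4^-1 * (d `^ b) ^+ 2 = (d `^ b / 2) ^+ 2 by field.
  by rewrite sqrtr_sqr ger0_norm ?divr_ge0//; field.
exists ud; split=> //.
- have h0 : 0 < 2^-1 :> R by rewrite invr_gt0.
  have h2 : 2^-1 < 2 :> R by lra.
  (* The rule eps t = d^(1/2) for small d; for larger d, when there is no root,
     the stopping time 0 does. *)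
  have /choice[td tdP] (d : R) : exists t, 0 <= t /\
      ((exists t', 0 <= t' /\ eps t' = 1 * d `^ 2^-1) -> eps t = 1 * d `^ 2^-1).
    have [[t [t0 te]]|no] := pselect (exists t', 0 <= t' /\ eps t' = 1 * d `^ 2^-1).
      by exists t.
    by exists 0; split.
  exists td; split=> [d _|]; first exact: (tdP d).1.
  apply: (rule td 1 2^-1); rewrite ?h0 ?h2//.
  by apply: filterS (root 1 2^-1 ltr01 h0) => d ex; split; [exact: (tdP d).1|exact: (tdP d).2 ex].
- move=> b /andP[b0 b1]; split.
    by apply: filterS (root 1 b ltr01 b0) => d [t]; rewrite mul1r; exists t.
  move=> td tdP; apply: (rule td 1 b) => //; first by rewrite b0/=; lra.
  by apply: filterS tdP => d; rewrite mul1r.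
- move=> b /andP[b0 b1].
  have q0 : 0 < 4^-1 :> R by rewrite invr_gt0.
  have b20 : 0 < b * 2 by rewrite mulr_gt0.
  split.
    near=> d; have d0 : 0 < d by near: d; exact: nbhs_right_gt.
    have [t [t0 te]] : exists t, 0 <= t /\ eps t = 4^-1 * d `^ (b * 2).
      by near: d; exact: root.
    by exists t; split=> //; apply/sqrt_rule.
  move=> td tdP; apply: (rule td 4^-1 (b * 2)) => //; first by rewrite b20/=; lra.
  near=> d; have d0 : 0 < d by near: d; exact: nbhs_right_gt.
  have [t0 te] : 0 <= td d /\ 2 * Num.sqrt (eps (td d)) = d `^ b by near: d.
  by split=> //; apply/(sqrt_rule b).
Unshelve. all: by end_near. Qed.
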